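(* Any polynomial $p$ in one complex variable is completely Lipschitz in small scale as a map $B_{\mathbb C}\to\mathbb C$. More generally, if $A\subseteq\mathcal B(H)$ is an operator algebra (with its induced operator space structure), then $p\colon B_A\to A$ is completely Lipschitz in small scale.
   Context: An operator space is a Banach (closed linear) subspace $X\subseteq\mathcal B(H)$ of the bounded operators on a complex Hilbert space $H$. For $n\in\mathbb N$, $\mathrm M_n(X)$ is the space of $n\times n$ matrices with entries in $X$, normed through $\mathrm M_n(X)\subseteq\mathrm M_n(\mathcal B(H))\cong\mathcal B(H^{\oplus n})$, where $H^{\oplus n}$ is the Hilbert sum of $n$ copies of $H$. $B_E$ denotes the closed unit ball of a normed space $E$. An operator algebra is an operator space $A\subseteq\mathcal B(H)$ that is also a subalgebra of $\mathcal B(H)$. The map $p\colon B_A\to A$ is $a\mapsto p(a)$, the evaluation of the polynomial $p$ at $a$. For a map $f\colon B_X\to Y$ between operator spaces, the $n$-amplification is $f_n([x_{ij}])=[f(x_{ij})]$, considered on $B_{\mathrm M_n(X)}$ (whose elements have all entries in $B_X$). The small scale modulus of uniform continuity of $f$ is $$\omega_f^{\mathrm{ss}}(t)=\sup_{n\in\mathbb N}\ \sup\big\{\|f_n(x)-f_n(y)\|_{\mathrm M_n(Y)} : x,y\in B_{\mathrm M_n(X)},\ \|x-y\|_{\mathrm M_n(X)}\le t\big\},\qquad t\ge 0.$$ The map $f$ is completely Lipschitz in small scale if there is $L>0$ such that $\omega_f^{\mathrm{ss}}(t)\le Lt$ for all $t\ge 0$. *)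

(* Defs.v *)
From HB Require Import structures.
From mathcomp Require Import all_boot all_order all_algebra.
From mathcomp Require Import sesquilinear complex.
From mathcomp Require Import all_classical all_reals all_analysis.

Set Implicit Arguments.
Unset Strict Implicit.
Unset Printing Implicit Defensive.

Import Order.TTheory GRing.Theory Num.Theory.
Import numFieldNormedType.Exports.

Local Open Scope classical_set_scope.
Local Open Scope ring_scope.

(* The complex numbers are R[i] for R : realType; a norm on an R[i]-module
   takes (real) values in R[i], and rnorm is the same number seen in R. *)
Definition rnorm (R : realType) (H : normedModType R[i]) (h : H) : R :=
  complex.Re `|h|.

Definition hilbert_space (R : realType) (H : completeNormedModType R[i]) : Prop :=
  exists dot : {dot H for (@Num.conj R[i])}, forall h : H, dot h h = `|h| ^+ 2.

(* Norms of operators are suprema in \bar R, so that they make sense for every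
   function H -> H and no default value is involved. *)
Definition opnorm (R : realType) (H : normedModType R[i]) (T : H -> H) : \bar R :=
  ereal_sup [set (rnorm (T h))%:E | h in [set h : H | rnorm h <= 1]].

Definition bounded_op (R : realType) (H : normedModType R[i]) (T : H -> H) : Prop :=
  linear T /\ (opnorm T < +oo)%E.

(* The norm of the Hilbert sum of n copies of H; the library norm on 'cV[H]_n
   is the maximum norm and is not used. *)
Definition hsum_norm (R : realType) (H : normedModType R[i]) (n : nat)
    (h : 'cV[H]_n) : R :=
  Num.sqrt (\sum_i rnorm (h i 0) ^+ 2).

Definition opmx_apply (R : realType) (H : normedModType R[i]) (n : nat)
    (T : 'M[H -> H]_n) (h : 'cV[H]_n) : 'cV[H]_n :=
  \col_i \sum_j T i j (h j 0).

Definition opmx_norm (R : realType) (H : normedModType R[i]) (n : nat)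
    (T : 'M[H -> H]_n) : \bar R :=
  ereal_sup [set (hsum_norm (opmx_apply T h))%:E
            | h in [set h : 'cV[H]_n | hsum_norm h <= 1]].

Definition operator_space (R : realType) (H : normedModType R[i])
    (X : set (H -> H)) : Prop :=
  [/\ X `<=` [set T | bounded_op T],
      X 0,
      forall (c : R[i]) (S T : H -> H), X S -> X T -> X (c *: S + T) &
      forall T : H -> H, bounded_op T ->
        (forall e : R, 0 < e -> exists2 S, X S & (opnorm (T - S)%R < e%:E)%E) ->
        X T].

(* No identity element is required. *)
Definition operator_algebra (R : realType) (H : normedModType R[i])
    (A : set (H -> H)) : Prop :=
  operator_space A /\ forall S T : H -> H, A S -> A T -> A (S \o T).

(* In omega_ss and completely_lipschitz_ss an operator space is a subset X of
   a module V realized as operators on H by iota : V -> (H -> H), and the norm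
   of a matrix over V is that of its image under iota. For X included in B(H)
   itself iota is the identity; for the complex numbers it is scalar_op. *)
Definition omega_ss (R : realType) (H K : normedModType R[i]) (V W : zmodType)
    (iota : V -> (H -> H)) (kappa : W -> (K -> K)) (X : set V) (f : V -> W)
    (t : R) : \bar R :=
  ereal_sup [set s : \bar R | exists n (x y : 'M[V]_n),
    [/\ (0 < n)%N,
        (forall i j, X (x i j)) /\ (opmx_norm (map_mx iota x) <= 1)%E,
        (forall i j, X (y i j)) /\ (opmx_norm (map_mx iota y) <= 1)%E,
        (opmx_norm (map_mx iota (x - y)%R) <= t%:E)%E &
        s = opmx_norm (map_mx kappa (map_mx f x - map_mx f y))]].

Definition completely_lipschitz_ss (R : realType) (H K : normedModType R[i])
    (V W : zmodType) (iota : V -> (H -> H)) (kappa : W -> (K -> K))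
    (X : set V) (f : V -> W) : Prop :=
  exists2 L : R, 0 < L &
    forall t : R, 0 <= t -> (omega_ss iota kappa X f t <= (L * t)%R%:E)%E.

(* The identification of the complex numbers with the bounded operators on the
   one-dimensional Hilbert space. *)
Definition scalar_op (R : realType) (z : R[i]) : R[i]^o -> R[i]^o :=
  fun w => z * w.

(* The identity operator is always neutral on A (neutral_on_id); when A has a
   unit, that unit is neutral on A and need not be the identity operator. *)
Definition neutral_on (R : realType) (H : normedModType R[i])
    (A : set (H -> H)) (e : H -> H) : Prop :=
  bounded_op e /\ forall a, A a -> e \o a = a /\ a \o e = a.

Lemma neutral_on_id (R : realType) (H : normedModType R[i])
    (A : set (H -> H)) : neutral_on A id.
Proof.
split=> //; split=> //; apply: (@le_lt_trans _ _ 1%E); last exact: ltry.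
by apply: ge_ereal_sup => _ [h h1 <-]; rewrite lee_fin.
Qed.

(* p(a) = \sum_i p_i a^i with the convention a^0 = e. *)
Definition op_horner (R : realType) (H : normedModType R[i]) (e : H -> H)
    (p : {poly R[i]}) (a : H -> H) : H -> H :=
  \sum_(i < size p) p`_i *: iter i (fun T : H -> H => a \o T) e.

(* Main.v *)
Require Import Defs.
From mathcomp Require Import all_boot all_order all_algebra.
From mathcomp Require Import complex ring.
From mathcomp Require Import all_classical all_reals all_analysis.

Set Implicit Arguments.
Unset Strict Implicit.
Unset Printing Implicit Defensive.

Import Order.TTheory GRing.Theory Num.Theory.
Import numFieldNormedType.Exports.
Local Open Scope classical_set_scope.
Local Open Scope ring_scope.

(** Write S [] T for the Schur product [S_ij \o T_ij] of two n x n matrices of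
    operators.  Everything rests on its submultiplicativity,
      ||S [] T|| <= ||S|| ||T||   for every n,
    which holds although the entries do not commute.  Indeed each row of S and
    each column of T is a compression of the whole matrix, so
      ||\sum_j S_ij v_j||^2 <= ||S||^2 \sum_j ||v_j||^2   and
      \sum_i ||T_ij g||^2 <= ||T||^2 ||g||^2.
    Take v_j = T_ij h_j in the first, sum over i, and use the second on each
    column: the outcome is ||(S [] T) h||^2 <= ||S||^2 ||T||^2 ||h||^2.

    The amplification of a |-> a^k is the k-th Schur power x^[k], and
      x^[k+1] - y^[k+1] = x [] (x^[k] - y^[k]) + (x - y) [] y^[k].
    In the unit ball the Schur powers stay in the unit ball, so induction on k
    gives ||x^[k] - y^[k]|| <= k ||x - y|| (opmx_bounded_powB).  Summing over
    the monomials of p yields the Lipschitz constant \sum_k k |p_k|, the same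
    for all n; the constant term cancels in the difference.

    The scalar case is the same estimate for multiplication operators on the
    one-dimensional space, with the identity as the zeroth power. *)

(** * The triangle inequality for finite l^2 sums *)

Lemma cauchy_schwarz_sum (R : realDomainType) (I : finType) (a b : I -> R) :
  (\sum_i a i * b i) ^+ 2 <= (\sum_i a i ^+ 2) * (\sum_i b i ^+ 2).
Proof.
suff: (\sum_i a i * b i) ^+ 2 *+ 2
    <= (\sum_i a i ^+ 2) * (\sum_i b i ^+ 2) *+ 2 by rewrite lerMn2r.
rewrite -subr_ge0.
(* Lagrange's identity: the defect is a sum of squares. *)
suff -> : ((\sum_i a i ^+ 2) * (\sum_i b i ^+ 2)) *+ 2
          - ((\sum_i a i * b i) ^+ 2) *+ 2
        = \sum_i \sum_j (a i * b j - a j * b i) ^+ 2.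
  by do 2![apply: sumr_ge0 => ? _]; apply: sqr_ge0.
pose S := \sum_i \sum_j a i ^+ 2 * b j ^+ 2.
pose P := \sum_i \sum_j (a i * b i) * (a j * b j).
have -> : (\sum_i a i ^+ 2) * (\sum_i b i ^+ 2) = S by rewrite big_distrlr.
have -> : (\sum_i a i * b i) ^+ 2 = P by rewrite expr2 big_distrlr.
transitivity (S + S - (P + P)); first by rewrite !mulr2n.
have {2}-> : S = \sum_i \sum_j a j ^+ 2 * b i ^+ 2 by rewrite /S exchange_big.
rewrite -!big_split -sumrB; apply: eq_bigr => i _ /=.
rewrite -!big_split -sumrB; apply: eq_bigr => j _ /=.
by ring.
Qed.

Lemma minkowski_sum (R : rcfType) (I : finType) (a b : I -> R) :
  Num.sqrt (\sum_i (a i + b i) ^+ 2)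
  <= Num.sqrt (\sum_i a i ^+ 2) + Num.sqrt (\sum_i b i ^+ 2).
Proof.
have sqs (f : I -> R) : 0 <= \sum_i f i ^+ 2.
  by apply: sumr_ge0 => i _; apply: sqr_ge0.
rewrite -ler_sqr ?nnegrE ?addr_ge0 ?sqrtr_ge0// sqrrD !sqr_sqrtr//.
under eq_bigr do rewrite sqrrD.
rewrite !big_split /= -mulr2n lerD2r lerD2l lerMn2r /=.
rewrite -sqrtrM// (le_trans (ler_norm _))// -sqrtr_sqr ler_sqrt.
  exact: cauchy_schwarz_sum.
by rewrite mulr_ge0.
Qed.

(** * The norm of H and of its Hilbert sums *)

Section HilbertSumOperators.
Variables (R : realType) (H : normedModType R[i]).
Implicit Types (g h : H) (c : R[i]).

Lemma rnormE h : (rnorm h)%:C%C = `|h|.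
Proof. by rewrite /rnorm RRe_real ?normr_real. Qed.

Lemma rnorm_ge0 h : 0 <= rnorm h.
Proof. by rewrite -lecR rnormE normr_ge0. Qed.

Lemma rnorm0 : rnorm (0 : H) = 0.
Proof. by rewrite /rnorm normr0. Qed.

Lemma rnorm0_eq0 h : rnorm h = 0 -> h = 0.
Proof. by move=> h0; apply/eqP; rewrite -normr_eq0 -rnormE h0. Qed.

Lemma ler_rnormD g h : rnorm (g + h) <= rnorm g + rnorm h.
Proof. by rewrite -lecR rmorphD /= !rnormE ler_normD. Qed.

Lemma Re_norm_ge0 c : 0 <= complex.Re `|c|.
Proof. by rewrite -lecR RRe_real ?normr_real ?normr_ge0. Qed.

Lemma rnormZ c h : rnorm (c *: h) = complex.Re `|c| * rnorm h.
Proof.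
apply: complexI; rewrite rmorphM rnormE normrZ; congr (_ * _).
by apply/esym/RRe_real/normr_real.
Qed.

Lemma hsum_norm_ge0 n (h : 'cV[H]_n) : 0 <= hsum_norm h.
Proof. exact: sqrtr_ge0. Qed.

Lemma sqr_hsum_norm n (h : 'cV[H]_n) :
  hsum_norm h ^+ 2 = \sum_i rnorm (h i 0) ^+ 2.
Proof. by rewrite sqr_sqrtr// sumr_ge0// => i _; rewrite sqr_ge0. Qed.

Lemma hsum_norm0 n : hsum_norm (0 : 'cV[H]_n) = 0.
Proof.
by rewrite /hsum_norm big1 ?sqrtr0// => i _; rewrite mxE rnorm0 expr0n.
Qed.

Lemma rnorm_le_hsum_norm n (h : 'cV[H]_n) i :
  rnorm (h i 0) ^+ 2 <= hsum_norm h ^+ 2.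
Proof.
rewrite sqr_hsum_norm (bigD1 i)//= lerDl sumr_ge0// => j _.
exact: sqr_ge0.
Qed.

Lemma hsum_norm0_eq0 n (h : 'cV[H]_n) : hsum_norm h = 0 -> h = 0.
Proof.
move=> h0; apply/matrixP => i j; rewrite ord1 mxE; apply: rnorm0_eq0.
apply/eqP; rewrite -sqrf_eq0 eq_le sqr_ge0 andbT.
by rewrite (le_trans (rnorm_le_hsum_norm h i))// h0 expr0n.
Qed.

Lemma ler_hsum_normD n (g h : 'cV[H]_n) :
  hsum_norm (g + h) <= hsum_norm g + hsum_norm h.
Proof.
rewrite (le_trans _ (minkowski_sum _ _))//.
apply: ler_wsqrtr; apply: ler_sum => i _.
by rewrite mxE lerXn2r ?nnegrE ?addr_ge0 ?rnorm_ge0 ?ler_rnormD.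
Qed.

(** The scaling is stated entrywise because the scalars act on [H], whereas
    scaling a matrix means multiplying by an element of its entry type. *)
Lemma eq_hsum_normZ n c (g h : 'cV[H]_n) : (forall i, g i 0 = c *: h i 0) ->
  hsum_norm g = complex.Re `|c| * hsum_norm h.
Proof.
move=> gh; apply/eqP; rewrite -(@eqrXn2 _ 2) ?mulr_ge0 ?Re_norm_ge0 ?hsum_norm_ge0//.
rewrite exprMn !sqr_hsum_norm mulr_sumr; apply/eqP/eq_bigr => i _.
by rewrite gh rnormZ exprMn.
Qed.

(** * Norm bounds for operator matrices *)

Lemma linear_op0 (T : H -> H) : linear T -> T 0 = 0.
Proof. by move=> lT; have := lT (-1) 0 0; rewrite !scaleN1r oppr0 addr0 addNr. Qed.

Lemma linear_opZ (T : H -> H) c h : linear T -> T (c *: h) = c *: T h.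
Proof. by move=> lT; have := lT c h 0; rewrite !addr0 linear_op0// addr0. Qed.

Lemma linear_opB (T : H -> H) g h : linear T -> T (g - h) = T g - T h.
Proof. by move=> lT; have := lT (-1) h g; rewrite !scaleN1r ![- _ + _]addrC. Qed.

(** [opmx_norm T <= C] in homogeneous form, over all vectors instead of the
    unit ball. *)
Definition opmx_bounded n (C : R) (T : 'M[H -> H]_n) : Prop :=
  forall h : 'cV[H]_n, hsum_norm (opmx_apply T h) <= C * hsum_norm h.

(** Homogeneity reduces a nonzero vector to a unit vector; this is where the
    linearity of the entries is needed. *)
Lemma opmx_norm_bounded n (C : R) (T : 'M[H -> H]_n) :
  (forall i j, linear (T i j)) -> (opmx_norm T <= C%:E)%E -> opmx_bounded C T.
Proof.
move=> lT TC h; have [h0|h0] := eqVneq (hsum_norm h) 0.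
  rewrite (hsum_norm0_eq0 h0) hsum_norm0 mulr0.
  suff -> : opmx_apply T 0 = 0 by rewrite hsum_norm0.
  apply/matrixP => i j; rewrite !mxE big1// => k _.
  by rewrite mxE linear_op0.
have hgt0 : 0 < hsum_norm h by rewrite lt_def h0 hsum_norm_ge0.
pose c : R[i] := (hsum_norm h)^-1%:C%C.
have Rec : complex.Re `|c| = (hsum_norm h)^-1.
  by rewrite ger0_norm// -[0]/(0%:C%C) lecR invr_ge0 ltW.
pose u : 'cV[H]_n := \col_i (c *: h i 0).
have u1 : hsum_norm u = 1.
  by rewrite (@eq_hsum_normZ _ c u h) ?Rec ?mulVf// => i; rewrite mxE.
have Tu : hsum_norm (opmx_apply T u) = hsum_norm (opmx_apply T h) / hsum_norm h.
  rewrite (@eq_hsum_normZ _ c _ (opmx_apply T h)) ?Rec 1?mulrC// => i.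
  rewrite !mxE scaler_sumr; apply: eq_bigr => j _.
  by rewrite mxE linear_opZ.
rewrite -ler_pdivrMr// -Tu -lee_fin (le_trans _ TC)//.
by apply: ereal_sup_ubound; exists u => //=; rewrite u1.
Qed.

Lemma bounded_opmx_norm n (C : R) (T : 'M[H -> H]_n) :
  0 <= C -> opmx_bounded C T -> (opmx_norm T <= C%:E)%E.
Proof.
move=> C0 TC; apply: ge_ereal_sup => _ [h /= h1 <-].
by rewrite lee_fin (le_trans (TC h))// ler_piMr.
Qed.

Lemma opmx_boundedD n (C D : R) (S T : 'M[H -> H]_n) :
  opmx_bounded C S -> opmx_bounded D T -> opmx_bounded (C + D) (S + T).
Proof.
move=> SC TD h; have -> : opmx_apply (S + T) h = opmx_apply S h + opmx_apply T h.
  apply/matrixP => i j; rewrite !mxE -big_split; apply: eq_bigr => k _.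
  by rewrite mxE.
by rewrite (le_trans (ler_hsum_normD _ _))// mulrDl lerD.
Qed.

Lemma opmx_boundedZ n c (C : R) (T : 'M[H -> H]_n) :
  opmx_bounded C T ->
  opmx_bounded (complex.Re `|c| * C) (map_mx (fun S : H -> H => c *: S) T).
Proof.
move=> TC h; rewrite (@eq_hsum_normZ _ c _ (opmx_apply T h)).
  by rewrite -mulrA ler_wpM2l ?Re_norm_ge0.
move=> i; rewrite !mxE scaler_sumr; apply: eq_bigr => j _.
by rewrite mxE.
Qed.

Lemma opmx_bounded0 n : opmx_bounded 0 (0 : 'M[H -> H]_n).
Proof.
move=> h; suff -> : opmx_apply 0 h = 0 by rewrite hsum_norm0 mul0r.
by apply/matrixP => i j; rewrite !mxE big1// => k _; rewrite mxE.
Qed.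

Lemma opmx_bounded_sum n m (C : 'I_m -> R) (T : 'I_m -> 'M[H -> H]_n) :
  (forall k, opmx_bounded (C k) (T k)) ->
  opmx_bounded (\sum_k C k) (\sum_k T k).
Proof.
move=> TC; elim/big_ind2: _ => // [|D S E U SD UE]; first exact: opmx_bounded0.
exact: opmx_boundedD.
Qed.

(** The [i]-th row of [T] applied to [v] is a coordinate of [T v], hence no
    longer than [T v]. *)
Lemma opmx_bounded_row n (C : R) (T : 'M[H -> H]_n) i (v : 'I_n -> H) :
  opmx_bounded C T ->
  rnorm (\sum_j T i j (v j)) ^+ 2 <= C ^+ 2 * \sum_j rnorm (v j) ^+ 2.
Proof.
move=> TC; pose h : 'cV[H]_n := \col_j v j.
have -> : \sum_j T i j (v j) = opmx_apply T h i 0.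
  by rewrite mxE; apply: eq_bigr => j _; rewrite mxE.
have -> : \sum_j rnorm (v j) ^+ 2 = hsum_norm h ^+ 2.
  by rewrite sqr_hsum_norm; apply: eq_bigr => j _; rewrite mxE.
rewrite (le_trans (rnorm_le_hsum_norm _ i))// -exprMn.
by rewrite lerXn2r ?nnegrE ?hsum_norm_ge0// (le_trans (hsum_norm_ge0 _) (TC h)).
Qed.

(** Column [j] of [T] is the image under [T] of a vector supported at [j]. *)
Lemma opmx_bounded_col n (C : R) (T : 'M[H -> H]_n) j g :
  (forall i k, T i k 0 = 0) -> opmx_bounded C T ->
  \sum_i rnorm (T i j g) ^+ 2 <= C ^+ 2 * rnorm g ^+ 2.
Proof.
move=> T0 TC; pose h : 'cV[H]_n := \col_k if k == j then g else 0.
have -> : \sum_i rnorm (T i j g) ^+ 2 = hsum_norm (opmx_apply T h) ^+ 2.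
  rewrite sqr_hsum_norm; apply: eq_bigr => i _; rewrite mxE (bigD1 j)//=.
  rewrite mxE eqxx big1 ?addr0// => k /negPf kj.
  by rewrite mxE kj T0.
have -> : rnorm g ^+ 2 = hsum_norm h ^+ 2.
  rewrite sqr_hsum_norm (bigD1 j)//= mxE eqxx big1 ?addr0// => k /negPf kj.
  by rewrite mxE kj rnorm0 expr0n.
rewrite -exprMn.
by rewrite lerXn2r ?nnegrE ?hsum_norm_ge0// (le_trans (hsum_norm_ge0 _) (TC h)).
Qed.

(** * Schur products of operator matrices *)

Definition schur_comp n (S T : 'M[H -> H]_n) : 'M[H -> H]_n :=
  \matrix_(i, j) (S i j \o T i j).

(** The row estimate for [S] at the vector [T_ij h_j], summed over the rows [i],
    leaves the column estimates for [T].  That [T_ij] vanishes at 0 is what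
    makes its columns accessible by vectors with a single nonzero entry. *)
Lemma opmx_bounded_schur n (C D : R) (S T : 'M[H -> H]_n) :
  0 <= C -> 0 <= D -> (forall i j, T i j 0 = 0) ->
  opmx_bounded C S -> opmx_bounded D T ->
  opmx_bounded (C * D) (schur_comp S T).
Proof.
move=> C0 D0 T0 SC TD h.
rewrite -ler_sqr ?nnegrE ?mulr_ge0 ?hsum_norm_ge0// !exprMn !sqr_hsum_norm.
have rows i : rnorm (opmx_apply (schur_comp S T) h i 0) ^+ 2
    <= C ^+ 2 * \sum_j rnorm (T i j (h j 0)) ^+ 2.
  rewrite mxE; under eq_bigr do rewrite mxE /=.
  exact: opmx_bounded_row.
rewrite (le_trans (ler_sum _ (fun i _ => rows i)))// -mulr_sumr -mulrA.
rewrite ler_wpM2l ?sqr_ge0// exchange_big mulr_sumr /=.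
by apply: ler_sum => j _; apply: opmx_bounded_col.
Qed.

(** * Schur powers and polynomials *)

Definition op_pow (e : H -> H) k (a : H -> H) : H -> H :=
  iter k (fun T : H -> H => a \o T) e.

Section Powers.
Variables (e : H -> H) (n : nat) (x y : 'M[H -> H]_n) (t : R).
Hypotheses (lx : forall i j, linear (x i j)) (ly : forall i j, linear (y i j)).
Hypotheses (xe : forall i j, x i j \o e = x i j).
Hypotheses (ye : forall i j, y i j \o e = y i j).
Hypotheses (x1 : opmx_bounded 1 x) (y1 : opmx_bounded 1 y).
Hypotheses (t0 : 0 <= t) (xyt : opmx_bounded t (x - y)).

Lemma op_powS_0 (z : 'M[H -> H]_n) k i j : (forall i j, linear (z i j)) ->
  (forall i j, z i j \o e = z i j) -> op_pow e k.+1 (z i j) 0 = 0.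
Proof.
move=> lz ze; elim: k => [|k IHk].
  by rewrite -[LHS]/((z i j \o e) 0) ze linear_op0.
by rewrite /op_pow iterS /= in IHk *; rewrite IHk linear_op0.
Qed.

Lemma map_op_pow1 (z : 'M[H -> H]_n) :
  (forall i j, z i j \o e = z i j) -> map_mx (op_pow e 1) z = z.
Proof. by move=> ze; apply/matrixP => i j; rewrite mxE -[RHS]ze. Qed.

Lemma opmx_bounded_pow k : opmx_bounded 1 (map_mx (op_pow e k.+1) y).
Proof.
elim: k => [|k IHk].
  by rewrite map_op_pow1.
have -> : map_mx (op_pow e k.+2) y = schur_comp y (map_mx (op_pow e k.+1) y).
  by apply/matrixP => i j; rewrite !mxE.
rewrite -[1]mulr1; apply: opmx_bounded_schur => // i j.
by rewrite mxE op_powS_0.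
Qed.

(** Telescoping, one factor at a time: [x] and the powers of [y] are
    contractions for the Schur product, so each step adds at most [t]. *)
Lemma opmx_bounded_powB k :
  opmx_bounded (k%:R * t) (map_mx (op_pow e k) x - map_mx (op_pow e k) y).
Proof.
case: k => [|k].
  have -> : map_mx (op_pow e 0) x - map_mx (op_pow e 0) y = 0.
    by apply/matrixP => i j; rewrite !mxE subrr.
  by rewrite mul0r; apply: opmx_bounded0.
elim: k => [|k IHk].
  by rewrite mul1r !map_op_pow1.
set X := map_mx (op_pow e k.+1) x; set Y := map_mx (op_pow e k.+1) y.
have -> : map_mx (op_pow e k.+2) x - map_mx (op_pow e k.+2) y
    = schur_comp x (X - Y) + schur_comp (x - y) Y.
  apply/matrixP => i j; apply/funext => h; rewrite !mxE.
  set u := op_pow e k.+1 (x i j); set v := op_pow e k.+1 (y i j).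
  rewrite -[LHS]/(x i j (u h) - y i j (v h)).
  rewrite -[RHS]/(x i j (u h - v h) + (x i j (v h) - y i j (v h))).
  by rewrite (linear_opB _ _ (lx i j)) addrA subrK.
rewrite -natr1 mulrDl mul1r; apply: opmx_boundedD.
  rewrite -[_ * t]mul1r; apply: opmx_bounded_schur; rewrite ?mulr_ge0// => i j.
  by rewrite !mxE !fctE !op_powS_0// subrr.
rewrite -[t]mulr1; apply: opmx_bounded_schur => // [i j|].
  by rewrite mxE op_powS_0.
exact: opmx_bounded_pow.
Qed.

Lemma opmx_bounded_hornerB (p : {poly R[i]}) :
  opmx_bounded (\sum_(k < size p) complex.Re `|p`_k| * (k%:R * t))
    (map_mx (op_horner e p) x - map_mx (op_horner e p) y).
Proof.
have -> : map_mx (op_horner e p) x - map_mx (op_horner e p) y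
  = \sum_(k < size p) map_mx (fun S : H -> H => p`_k *: S)
      (map_mx (op_pow e k) x - map_mx (op_pow e k) y).
  apply/matrixP => i j; rewrite !mxE summxE /op_horner -sumrB.
  by apply: eq_bigr => k _; rewrite !mxE scalerBr.
by apply: opmx_bounded_sum => k; apply/opmx_boundedZ/opmx_bounded_powB.
Qed.

End Powers.

(** A majorant of the modulus of the derivative of [p] on the unit disc. *)
Definition poly_lip (p : {poly R[i]}) : R :=
  \sum_(k < size p) complex.Re `|p`_k| * k%:R.

Lemma poly_lip_ge0 p : 0 <= poly_lip p.
Proof. by apply: sumr_ge0 => k _; rewrite mulr_ge0 ?Re_norm_ge0. Qed.

(** The summand 1 keeps the Lipschitz constant positive when [p] is constant. *)
Lemma opmx_norm_hornerB (e : H -> H) (p : {poly R[i]}) (t : R) n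
    (x y : 'M[H -> H]_n) :
  (forall i j, linear (x i j) /\ x i j \o e = x i j) ->
  (forall i j, linear (y i j) /\ y i j \o e = y i j) -> 0 <= t ->
  (opmx_norm x <= 1)%E -> (opmx_norm y <= 1)%E ->
  (opmx_norm (x - y) <= t%:E)%E ->
  (opmx_norm (map_mx (op_horner e p) x - map_mx (op_horner e p) y)%R
   <= ((1 + poly_lip p) * t)%:E)%E.
Proof.
move=> xe ye t0 x1 y1 xyt.
have lx i j : linear (x i j) by have [] := xe i j.
have ly i j : linear (y i j) by have [] := ye i j.
have lxy i j : linear ((x - y) i j).
  move=> c g h; rewrite !mxE !fctE lx ly scalerBr opprD !addrA.
  by congr (_ - _); rewrite -!addrA; congr (_ + _); rewrite addrC.
apply: (@le_trans _ _ (poly_lip p * t)%:E); last first.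
  by rewrite lee_fin ler_wpM2r// lerDr.
apply: bounded_opmx_norm; first by rewrite mulr_ge0 ?poly_lip_ge0.
rewrite /poly_lip mulr_suml; under eq_bigr do rewrite -mulrA.
apply: opmx_bounded_hornerB => //.
- by move=> i j; have [] := xe i j.
- by move=> i j; have [] := ye i j.
- exact: opmx_norm_bounded.
- exact: opmx_norm_bounded.
- exact: opmx_norm_bounded.
Qed.

(** Powers of positive exponent lie in [A] by closure under composition; the
    zeroth power [e] either lies in [A] or has coefficient zero. *)
Lemma op_horner_mem (A : set (H -> H)) (e : H -> H) (p : {poly R[i]}) a :
  operator_algebra A -> neutral_on A e -> A e \/ p`_0 = 0 -> A a ->
  A (op_horner e p a).
Proof.
move=> [[_ A0 Alin _] Acomp] [_ Ae] ep Aa.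
have AaS k : A (op_pow e k.+1 a).
  elim: k => [|k IHk]; last exact: Acomp.
  by rewrite /op_pow /= (Ae a Aa).2.
apply: big_ind => // [S T AS AT|k _].
  by rewrite -[S]scale1r; apply: Alin.
rewrite -[_ *: _]addr0; case: k => -[|k] _ /=; last exact: Alin (AaS k) A0.
case: ep => [Ae1|->]; first exact: Alin.
by rewrite scale0r addr0.
Qed.

End HilbertSumOperators.

(** Multiplication operators turn evaluation of [p] into the operator calculus,
    so that the scalar case is an instance of the operator estimate. *)
Lemma scalar_op_horner (R : realType) (p : {poly R[i]}) (z : R[i]) :
  scalar_op p.[z] = op_horner id p (scalar_op z).
Proof.
apply/funext => w; rewrite /scalar_op /op_horner horner_coef fct_sumE mulr_suml.
apply: eq_bigr => k _; rewrite fctE -mulrA; congr (_ * _).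
by elim: (k : nat) => [|l IHl]; rewrite ?mul1r// iterS /= -IHl exprS mulrA.
Qed.

Theorem theorem1p5 (R : realType) (p : {poly R[i]}) :
  completely_lipschitz_ss (@scalar_op R) (@scalar_op R) setT
    (fun z : R[i] => p.[z])
  /\
  (forall (H : completeNormedModType R[i]) (A : set (H -> H)) (e : H -> H),
     hilbert_space H -> operator_algebra A -> neutral_on A e ->
     (A e \/ p`_0 = 0 ->
        forall a : H -> H, A a -> (opnorm a <= 1)%E -> A (op_horner e p a))
     /\ completely_lipschitz_ss (@idfun (H -> H)) (@idfun (H -> H)) A
          (op_horner e p)).
Proof.
have L0 : 0 < 1 + poly_lip p.
  by rewrite (lt_le_trans ltr01)// lerDl poly_lip_ge0.
split.
  exists (1 + poly_lip p) => // t t0; apply: ge_ereal_sup => s.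
  move=> [n [x [y [_ [_ x1] [_ y1] xyt ->]]]].
  have sB (u v : 'M[R[i]]_n) :
      map_mx (@scalar_op R) (u - v)
      = map_mx (@scalar_op R) u - map_mx (@scalar_op R) v.
    by apply/matrixP => i j; apply/funext => w; rewrite !mxE /scalar_op mulrBl.
  have sL (u : 'M[R[i]]_n) i j : linear (map_mx (@scalar_op R) u i j) /\
      map_mx (@scalar_op R) u i j \o id = map_mx (@scalar_op R) u i j.
    split=> // c g h; rewrite !mxE /scalar_op mulrDr; congr (_ + _).
    by rewrite mulrCA.
  have sp (u : 'M[R[i]]_n) : map_mx (@scalar_op R) (map_mx (fun z => p.[z]) u)
      = map_mx (op_horner id p) (map_mx (@scalar_op R) u).
    by apply/matrixP => i j; rewrite !mxE scalar_op_horner.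
  rewrite sB in xyt.
  rewrite sB.
  rewrite !sp.
  exact: (opmx_norm_hornerB p (sL x) (sL y) t0 x1 y1 xyt).
move=> H A e _ algA neutA; split=> [ep a Aa _|]; first exact: op_horner_mem.
exists (1 + poly_lip p) => // t t0; apply: ge_ereal_sup => s.
move=> [n [x [y [_ [Ax x1] [Ay y1] xyt ->]]]].
have mapid (u : 'M[H -> H]_n) : map_mx idfun u = u.
  by apply/matrixP => i j; rewrite mxE.
rewrite mapid in x1; rewrite mapid in y1; rewrite mapid in xyt.
rewrite mapid.
have neut (u : 'M[H -> H]_n) : (forall i j, A (u i j)) ->
    forall i j, linear (u i j) /\ u i j \o e = u i j.
  move=> Au i j; have [[Ab _ _ _] _] := algA.
  by have [lu _] := Ab _ (Au i j); have [_ ue] := neutA.2 _ (Au i j).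
exact: (opmx_norm_hornerB p (neut _ Ax) (neut _ Ay) t0 x1 y1 xyt).
Qed.
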